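(* There is a function $\varepsilon_d$ with $\varepsilon_d\to 0$ as $d\to\infty$ such that the following holds. There is a constant $\gamma$ (independent of $n$) such that, for any integer $k\leq(1-\varepsilon_d)\frac{\ln d}{d}\cdot n$, with high probability the set $\mathcal{S}_k(G(n,m))$ is $\gamma$-connected.
   Context: $G(n,m)$ is the random graph on vertex set $V=\{1,\dots,n\}$ obtained by choosing $m$ edges uniformly at random without replacement; $d=2m/n$ is the average degree, which is held fixed as $n\to\infty$. ''With high probability'' (w.h.p.) means with probability tending to $1$ as $n\to\infty$. For a graph $G$ and an integer $k$, $\mathcal{S}_k(G)$ denotes the set of all independent sets of $G$ of size exactly $k$. For $S,T\subseteq V$, $\mathrm{dist}(S,T)=|S\triangle T|$ (Hamming distance). A family $\mathcal{S}$ of subsets of $V$ is $\gamma$-connected if for any $\sigma,\tau\in\mathcal{S}$ there are $\sigma_1,\dots,\sigma_N\in\mathcal{S}$ with $\sigma_1=\sigma$, $\sigma_N=\tau$ and $\mathrm{dist}(\sigma_t,\sigma_{t+1})\leq\gamma$ for all $1\leq t<N$. *)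

(* Defs.v *)
From Stdlib Require Import Reals ClassicalEpsilon.
From mathcomp Require Import all_boot.

Set Implicit Arguments.
Unset Strict Implicit.
Unset Printing Implicit Defensive.

Open Scope R_scope.

Definition decP (P : Prop) : bool :=
  if excluded_middle_informative P then true else false.

(* A graph on V = 'I_n (i.e. {1..n}) is its edge set: a set of 2-subsets. *)
Definition edges_Kn (n : nat) : {set {set 'I_n}} := [set e : {set 'I_n} | #|e| == 2%N].

Definition Gnm_space (n m : nat) : {set {set {set 'I_n}}} :=
  [set E : {set {set 'I_n}} | (E \subset edges_Kn n) && (#|E| == m)].

Definition prob_Gnm (n m : nat) (P : {set {set 'I_n}} -> Prop) : R :=
  Rdiv (INR #|[set E in Gnm_space n m | decP (P E)]|)
       (INR #|Gnm_space n m|).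

Definition whp (p : nat -> R) : Prop :=
  forall e : R, 0 < e -> exists N : nat, forall n : nat, (N <= n)%N ->
    Rabs (p n - 1) < e.

Definition indep (n : nat) (E : {set {set 'I_n}}) (S : {set 'I_n}) : bool :=
  [forall e in E, ~~ (e \subset S)].

Definition Sk (n : nat) (E : {set {set 'I_n}}) (k : nat) : {set {set 'I_n}} :=
  [set S : {set 'I_n} | (#|S| == k) && indep E S].

Definition sdist (n : nat) (S T : {set 'I_n}) : nat :=
  #|(S :\: T) :|: (T :\: S)|.

Definition gamma_connected (n : nat) (F : {set {set 'I_n}}) (gamma : nat)
  : Prop :=
  forall sigma tau, sigma \in F -> tau \in F ->
    exists s : seq {set 'I_n},
      [/\ all (fun x => x \in F) s,
          path (fun a b => (sdist a b <= gamma)%N) sigma s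
        & last sigma s = tau].

(* Number of edges for average degree d: m = floor(d n / 2). *)
Definition m_of (d : R) (n : nat) : nat :=
  Z.to_nat (Int_part (d * INR n / 2)).

(* Main.v *)
Require Import Defs.
From Stdlib Require Import Reals Lra ClassicalEpsilon.
From mathcomp Require Import all_boot all_order all_algebra.
From mathcomp Require Import zify Rstruct.
Set Implicit Arguments.
Unset Strict Implicit.
Unset Printing Implicit Defensive.

(** With eps_d = 1 / sqrt (ln d) for large d, gamma = 2 suffices.  A vertex
    outside a k-set S has no neighbour in S with probability about
    (1 - d/n)^k >= exp (sqrt (ln d) - 1) / d, which beats the entropy
    O(ln^2 d / d) of choosing S together with a set of r^2 ~ n/d exceptional
    vertices.  Hence w.h.p. every k-set S, independent or not, has at least r^2
    outside vertices without neighbours in S.  Also w.h.p. all degrees are below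
    r ~ sqrt (n/d).  Greedily, the vertices isolated from an independent k-set
    then contain an independent set of size r, so every member of S_k extends to
    an independent set of size k + r.  This surplus allows one to insert any
    prescribed vertex of the target set after deleting its neighbours, one vertex
    at a time.  For small d, take eps_d = 1, which forces k = 0.

    Probabilities in G(n,m) are bounded through the generating function in
    y = m / (N - m), N = C(n,2), i.e. by comparison with G(n,p), at the cost of a
    factor N + 1. *)

(** * Independent sets and single-vertex swaps in a fixed graph *)

Section IndependentSets.
Local Open Scope nat_scope.
Variable n : nat.
Implicit Types (E : {set {set 'I_n}}) (A I S T W : {set 'I_n}) (u v : 'I_n).

Definition neighbours E v : {set 'I_n} := [set u | [set v; u] \in E].

Definition isolated_from E S : {set 'I_n} :=
  [set v | (v \notin S) && [disjoint neighbours E v & S]].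

Lemma card_extend_subset S A k :
  S \subset A -> #|S| <= k <= #|A| ->
  exists2 I : {set 'I_n}, S \subset I & I \subset A /\ #|I| = k.
Proof.
elim: k => [|k IHk] sSA /andP[leSk lekA].
  exists S => //; split=> //; lia.
have [eqSk | ltSk] := eqVneq #|S| k.+1; first by exists S.
have [|I sSI [sIA cI]] := IHk sSA; first by lia.
have /set0Pn[x] : A :\: I != set0.
  by rewrite -card_gt0 cardsD (setIidPr sIA) cI; lia.
rewrite inE => /andP[xI xA]; exists (x |: I).
  by apply: subset_trans sSI _; rewrite subsetUr.
by rewrite subUset sub1set xA sIA cardsU1 xI cI.
Qed.

Lemma indepS E S T : S \subset T -> indep E T -> indep E S.
Proof.
move=> sST /forall_inP indT; apply/forall_inP => e eE.
by apply: contra (indT e eE) => /subset_trans; apply.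
Qed.

Lemma edge_nbr E v e :
  E \subset edges_Kn n -> e \in E -> v \in e ->
  exists2 u, u \in neighbours E v & e = [set v; u].
Proof.
move=> /subsetP sE eE ve; move: (sE e eE); rewrite inE => /cards2P[x [y [xy def_e]]].
move: ve; rewrite def_e => /set2P[] ->.
  by exists y; rewrite // inE -def_e.
by exists x; [rewrite inE setUC -def_e | rewrite setUC].
Qed.

Lemma neighbours_irr E v : E \subset edges_Kn n -> v \notin neighbours E v.
Proof.
move=> /subsetP sE; rewrite inE; apply/negP => /sE.
by rewrite inE setUid cards1.
Qed.

Lemma indepU1 E v A : E \subset edges_Kn n ->
  indep E A -> [disjoint neighbours E v & A] -> indep E (v |: A).
Proof.
move=> sE /forall_inP indA dvA; apply/forall_inP => e eE; apply/negP => sevA.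
have [ve|nve] := boolP (v \in e).
  have [u uv def_e] := edge_nbr sE eE ve.
  have : u \in v |: A by apply: (subsetP sevA); rewrite def_e !inE eqxx orbT.
  rewrite !inE => /orP[/eqP uEv|uA].
    by case/negP: (neighbours_irr v sE); move: uv; rewrite uEv.
  by move: (disjointFr dvA uv); rewrite uA.
case/negP: (indA e eE); apply/subsetP => x xe.
have := subsetP sevA x xe; rewrite !inE => /orP[/eqP xv|//].
by rewrite -xv xe in nve.
Qed.

Lemma neighbours_indep E v T :
  indep E T -> v \in T -> [disjoint neighbours E v & T].
Proof.
move=> /forall_inP indT vT; apply/pred0P => u /=.
apply/negP => /andP[]; rewrite inE => /indT/negP uv uT; apply: uv.
by apply/subsetP => x /set2P[] ->.
Qed.

(** Take [I] maximal among the independent subsets of [W]. By maximality the closed neighbourhoods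
    of its vertices cover [W], and each has at most [r] elements, so [#|I| < r] would give
    [#|W| < r * r]. *)
Lemma exists_indep_subset E W r : E \subset edges_Kn n ->
  (forall v, #|neighbours E v| < r) -> r * r <= #|W| ->
  exists I, [/\ I \subset W, indep E I & r <= #|I|].
Proof.
move=> sE degE cW.
have ind0 : (set0 \subset W) && indep E set0.
  rewrite sub0set; apply/forall_inP => e /(subsetP sE).
  by rewrite inE subset0; apply: contraTneq => ->; rewrite cards0.
case: (@arg_maxnP _ set0 (fun I => (I \subset W) && indep E I) (fun I => #|I|) ind0).
move=> I /andP[sIW indI] maxI; exists I; split=> //.
rewrite leqNgt; apply/negP => ltIr.
have r_gt0 : 0 < r by lia.
have cover_W : W \subset \bigcup_(v in I) (v |: neighbours E v).
  apply/subsetP => w wW; have [wI|wI] := boolP (w \in I).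
    by apply/bigcupP; exists w => //; rewrite setU11.
  have [dw|] := boolP [disjoint neighbours E w & I].
    have := maxI (w |: I); rewrite indepU1 // subUset sub1set wW sIW cardsU1 wI.
    by move=> /(_ isT); rewrite /= ltnn.
  move=> /pred0Pn[v /= /andP[vw vI]]; apply/bigcupP; exists v => //.
  by rewrite !inE setUC; move: vw; rewrite inE => ->; rewrite orbT.
have : #|W| <= #|I| * r.
  apply: leq_trans (subset_leq_card cover_W) _.
  rewrite -sum_nat_const; elim/big_ind2: _ => [|a A b B leA leB|v vI].
  - by rewrite cards0.
  - by apply: leq_trans (leq_card_setU _ _) _; rewrite leq_add.
  - by rewrite cardsU1; move: (degE v); case: (v \notin _) => //=; apply: ltnW.
nia.
Qed.

Lemma indep_isolatedU E S I : E \subset edges_Kn n ->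
  indep E S -> indep E I -> I \subset isolated_from E S -> indep E (S :|: I).
Proof.
move=> sE indS indI sI; apply/forall_inP => e eE; apply/negP => seU.
have [/pred0Pn[v /= /andP[ve vI]]|disj] := boolP (~~ [disjoint e & I]).
  have [u uv def_e] := edge_nbr sE eE ve.
  have /(subsetP seU) : u \in e by rewrite def_e !inE eqxx orbT.
  have := subsetP sI v vI; rewrite inE => /andP[_ dvS].
  rewrite inE (disjointFr dvS uv) /= => uI.
  case/forall_inP/(_ e eE)/negP: indI; rewrite def_e.
  by apply/subsetP => x /set2P[] ->.
case/forall_inP/(_ e eE)/negP: indS; apply/subsetP => x xe.
move/negbNE: disj => disj.
by have := subsetP seU x xe; rewrite inE (disjointFr disj xe) orbF.
Qed.

(** The body of [gamma_connected] at distance 2 for a single pair, isolated so that paths can be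
    concatenated. *)
Definition swap_connected (E : {set {set 'I_n}}) k S T :=
  exists s : seq {set 'I_n},
    [/\ all (fun x => x \in Sk E k) s,
        path (fun a b => sdist a b <= 2) S s & last S s = T].

Lemma swap_connected_refl E k S : swap_connected E k S S.
Proof. by exists [::]. Qed.

Lemma swap_connected_trans E k S T W :
  swap_connected E k S T -> swap_connected E k T W -> swap_connected E k S W.
Proof.
move=> [s [sE sp <-]] [t [tE tp <-]]; exists (s ++ t).
by rewrite all_cat sE tE cat_path sp tp last_cat.
Qed.

(** Every subset of [A] is independent, so vertices of [S] outside [T] can be exchanged one by one
    for vertices of [T] outside [S]; the induction is on [#|T :\: S|]. *)
Lemma swap_connected_within E k A S T : indep E A ->
  S \subset A -> T \subset A -> #|S| = k -> #|T| = k -> swap_connected E k S T.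
Proof.
move=> indA; move: {2}_.+1 (ltnSn #|T :\: S|) => j; elim: j S => // j IHj S.
rewrite ltnS => leTSj sSA sTA cS cT.
have [sTS|] := boolP (T \subset S).
  suff -> : S = T by apply: swap_connected_refl.
  by apply/eqP; rewrite eq_sym eqEcard sTS cS cT leqnn.
rewrite -setD_eq0 => /set0Pn[x]; rewrite inE => /andP[xS xT].
have /set0Pn[y] : S :\: T != set0.
  rewrite -card_gt0 cardsD setIC; have : #|T :&: S| < #|T|.
    rewrite proper_card // properEneq subsetIl andbT; apply/eqP => /setIidPl.
    by move=> /subsetP/(_ x xT); rewrite (negPf xS).
  by lia.
rewrite inE => /andP[yT yS].
set S' := x |: S :\ y.
have xSy : x \notin S :\ y by rewrite inE negb_and xS orbT.
have cS' : #|S'| = k by rewrite cardsU1 xSy; move: (cardsD1 y S); rewrite yS cS; clear; lia.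
have sS'A : S' \subset A.
  by rewrite subUset sub1set (subsetP sTA) //= (subset_trans _ sSA) // subsetDl.
have ltTS'j : #|T :\: S'| < j.
  apply: leq_trans leTSj; apply: proper_card; apply/properP; split.
    apply/subsetP => z; rewrite !inE => /andP[]; rewrite negb_or negb_and negbK.
    move=> /andP[_ /orP[/eqP-> yT'|-> -> //]]; by rewrite yT' in yT.
  by exists x; rewrite !inE ?xT ?xS // eqxx.
have [s [sE sp lastT]] := IHj S' ltTS'j sS'A sTA cS' cT.
exists (S' :: s); split=> //=.
  by rewrite sE inE cS' eqxx (indepS sS'A).
rewrite sp andbT; apply: leq_trans (_ : #|[set x; y]| <= _).
  apply: subset_leq_card; apply/subsetP => z; rewrite !inE.
  by case: (z == x); case: (z == y); case: (z \in S).
by rewrite cards2; case: (_ != _).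
Qed.

(* To insert [v \in tau], the surplus of an enlarged set pays for deleting all
   neighbours of [v], none of which lies in [tau]. *)
Lemma swap_connected_of_surplus E k r : E \subset edges_Kn n ->
  (forall v, #|neighbours E v| <= r) ->
  (forall S, S \in Sk E k -> exists A, [/\ S \subset A, indep E A & k + r <= #|A|]) ->
  gamma_connected (Sk E k) 2.
Proof.
move=> sE degE extE S T + TE; rewrite -/(swap_connected E k S T).
move: {2}_.+1 (ltnSn #|T :\: S|) => j; elim: j S => // j IHj S.
rewrite ltnS => leTSj SE.
have [cS indS] : #|S| = k /\ indep E S by move: SE; rewrite inE => /andP[/eqP].
have [cT indT] : #|T| = k /\ indep E T by move: TE; rewrite inE => /andP[/eqP].
have [sTS|] := boolP (T \subset S).
  suff -> : S = T by apply: swap_connected_refl.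
  by apply/eqP; rewrite eq_sym eqEcard sTS cS cT leqnn.
rewrite -setD_eq0 => /set0Pn[v]; rewrite inE => /andP[vS vT].
have [A [sSA indA cA]] := extE S SE.
have dvT := neighbours_indep indT vT.
pose B := A :\: neighbours E v.
have sBA : B \subset A by apply: subsetDl.
have indvB : indep E (v |: B).
  apply: indepU1 => //; first exact: indepS sBA indA.
  by apply/pred0P => u /=; rewrite !inE; case: (_ \in E).
have sSTB : S :&: T \subset B.
  apply/subsetP => u; rewrite inE => /andP[uS uT].
  by rewrite inE (subsetP sSA) // andbT (disjointFl dvT).
have cB : k <= #|B|.
  have := leq_trans (subset_leq_card (subsetIr A (neighbours E v))) (degE v).
  by rewrite cardsD; move: cA; clear; lia.
have ltST : #|S :&: T| < k.
  rewrite -cT proper_card // properEneq subsetIr andbT; apply/eqP => /setIidPr.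
  by move=> /subsetP/(_ v vT); rewrite (negPf vS).
(* The walk passes through two intermediate sets that keep [S :&: T]: [S1] avoids the neighbours of
   [v], and [S2] contains [v]. The moves from [S] to [S1] stay inside [A], those from [S1] to [S2]
   inside [v |: B], and both are independent. *)
have [|S1 sS1 [sS1B cS1]] := @card_extend_subset (S :&: T) B k sSTB.
  by rewrite (ltnW ltST) cB.
have [||S2 sS2 [sS2B cS2]] := @card_extend_subset (v |: S :&: T) (v |: B) k.
- exact: setUS.
- rewrite cardsU1 !inE (negPf vS) /= add1n ltST /=.
  by apply: leq_trans cB (subset_leq_card (subsetUr _ _)).
apply: (@swap_connected_trans _ _ _ S1).
  by apply: swap_connected_within indA _ _ cS cS1; rewrite ?(subset_trans sS1B).
apply: (@swap_connected_trans _ _ _ S2).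
  apply: swap_connected_within indvB _ sS2B cS1 cS2.
  by apply: subset_trans sS1B (subsetUr _ _).
(* [S2] has lost no vertex of [S :&: T] and has gained [v], so fewer vertices of [T] are missing. *)
apply: IHj; last by rewrite inE cS2 eqxx (indepS sS2B).
apply: leq_trans leTSj; apply: proper_card; apply/properP; split.
  apply/subsetP => u; rewrite !inE => /andP[uS2 uT]; rewrite uT andbT.
  apply: contra uS2 => uS; apply: (subsetP sS2).
  by rewrite !inE uS uT orbT.
by exists v; rewrite !inE ?vT ?vS // (subsetP sS2) // setU11.
Qed.

(** An independent [r]-subset of the vertices isolated from [S] is disjoint from [S] and can be
    added to it, which provides the surplus. *)
Lemma gamma_connected_of_isolated E k r : E \subset edges_Kn n ->
  (forall v, #|neighbours E v| < r) ->
  (forall S, #|S| = k -> r * r <= #|isolated_from E S|) ->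
  gamma_connected (Sk E k) 2.
Proof.
move=> sE degE isoE.
apply: (@swap_connected_of_surplus E k r) => // [v|S]; first exact: ltnW.
rewrite inE => /andP[/eqP cS indS].
have [I [sI indI cI]] := exists_indep_subset sE degE (isoE S cS).
exists (S :|: I); split; rewrite ?subsetUl ?indep_isolatedU //.
rewrite cardsU cS; suff -> : S :&: I = set0 by rewrite cards0; lia.
apply/setP => x; rewrite !inE; apply/negP => /andP[xS /(subsetP sI)].
by rewrite inE xS.
Qed.

Lemma gamma_connected_Sk0 E : gamma_connected (Sk E 0) 2.
Proof.
move=> S T; rewrite !inE !cards_eq0 => /andP[/eqP-> _] /andP[/eqP-> _].
by exists [::].
Qed.

End IndependentSets.

(** * Generating functions over subsets and the binomial mode *)

Section SubsetSums.
Import Order.TTheory GRing.Theory Num.Theory.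
Local Open Scope ring_scope.
Variables (R : realFieldType) (T : finType).
Implicit Types (K E F : {set T}) (y : R).

Lemma sum_subset_prod (U : finType) (B : {set U}) (a : U -> R) :
  \sum_(D : {set U} | D \subset B) \prod_(v in D) a v = \prod_(v in B) (1 + a v).
Proof.
rewrite [RHS]big_mkcond /=.
under [RHS]eq_bigr => v _.
  have -> : (if v \in B then 1 + a v else 1) = (if v \in B then a v else 0) + 1.
    by case: ifP; rewrite ?add0r // addrC.
  over.
rewrite bigA_distr big_mkcond /=; apply: eq_bigr => D _.
case: ifP => [sDB|/negbT/subsetPn[v vD vB]].
  rewrite big_mkcond /=; apply: eq_bigr => v _.
  by case: ifP => // /(subsetP sDB) ->.
by rewrite (bigD1 v) //= vD (negPf vB) mul0r.
Qed.

Lemma sum_subset_weight K y : \sum_(E : {set T} | E \subset K) y ^+ #|E| = (1 + y) ^+ #|K|.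
Proof.
by under eq_bigr do rewrite -prodr_const; rewrite sum_subset_prod prodr_const.
Qed.

Lemma card_bigcup_disjoint (U : finType) (D : {set U}) (F : U -> {set T}) k :
  (forall v, v \in D -> #|F v| = k) ->
  (forall v w, v \in D -> w \in D -> v != w -> [disjoint F v & F w]) ->
  #|\bigcup_(v in D) F v| = (k * #|D|)%N.
Proof.
move=> cF disF; rewrite mulnC -sum_nat_const -(eq_bigr _ cF).
elim: {D}_.+1 {-2}D (ltnSn #|D|) cF disF => // j IHj D ltDj cF disF.
have [->|/set0Pn[v vD]] := eqVneq D set0; first by rewrite !big_set0 cards0.
rewrite !(big_setD1 v vD) /= cardsU IHj.
- rewrite (_ : _ :&: _ = set0) ?cards0 ?subn0 //.
  apply/eqP; rewrite setI_eq0 -setI_eq0; apply/eqP/setP => e; rewrite !inE.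
  apply/negP => /andP[ev /bigcupP[w]]; rewrite !inE => /andP[wv wD] ew.
  by have := disjointFr (disF v w vD wD _) ev; rewrite eq_sym wv ew => /(_ isT).
- by move: ltDj; rewrite (cardsD1 v D) vD.
- by move=> w; rewrite !inE => /andP[_]; apply: cF.
- by move=> w x; rewrite !inE => /andP[_ ?] /andP[_ ?]; apply: disF.
Qed.

(* Inclusion-exclusion over the set of families that [E] misses. *)
Lemma sum_subset_hitting (U : finType) (B : {set U}) (F : U -> {set T}) K k y :
  0 <= y ->
  (forall v, v \in B -> F v \subset K) -> (forall v, v \in B -> #|F v| = k) ->
  (forall v w, v \in B -> w \in B -> v != w -> [disjoint F v & F w]) ->
  \sum_(E : {set T} | (E \subset K) && [forall v in B, ~~ [disjoint E & F v]])
     y ^+ #|E| = (1 + y) ^+ #|K| * (1 - (1 + y) ^- k) ^+ #|B|.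
Proof.
move=> y0 sFK cF disF.
have u0 : 1 + y != 0 by apply: lt0r_neq0; apply: ltr_wpDr.
(* The indicator of hitting every [F v] is the product of the factors [1 - [disjoint E & F v]];
   expanding it, the term of [D] is the signed indicator of missing the whole union over [D]. *)
transitivity (\sum_(E : {set T} | E \subset K) \sum_(D : {set U} | D \subset B)
   (-1) ^+ #|D| * (if [disjoint E & \bigcup_(v in D) F v] then y ^+ #|E| else 0)).
  rewrite big_mkcondr; apply: eq_bigr => E _.
  transitivity (y ^+ #|E| * \prod_(v in B) (1 + - ([disjoint E & F v]%:R : R))).
    case: ifP => [/forall_inP hit | /negbT].
      by rewrite big1 ?mulr1 // => v /hit/negPf->; rewrite subr0.
    rewrite negb_forall => /existsP[v]; rewrite negb_imply negbK => /andP[vB dv].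
    by rewrite (bigD1 v) //= dv subrr mul0r mulr0.
  rewrite -sum_subset_prod big_distrr /=; apply: eq_bigr => D sDB.
  rewrite prodrN mulrCA; congr (_ * _).
  case: ifP => [dis|/negbT].
    rewrite big1 ?mulr1 // => v vD; rewrite (_ : [disjoint _ & _]) //.
    by apply: disjointWr dis; apply: bigcup_sup.
  move=> /pred0Pn[e /= /andP[eE /bigcupP[v vD ev]]].
  rewrite (bigD1 v) //= (_ : [disjoint _ & _] = false) ?mul0r ?mulr0 //.
  by apply/pred0Pn; exists e; rewrite /= eE ev.
rewrite exchange_big /=.
(* By disjointness the union over [D] has [k * #|D|] elements, so the sum over the sets [E] missing
   it is [(1 + y) ^+ #|K|] times one factor [(1 + y) ^- k] per element of [D], and the sum over [D]
   refolds into a product. *)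
transitivity (\sum_(D : {set U} | D \subset B)
    (1 + y) ^+ #|K| * \prod_(v in D) - ((1 + y) ^- k)); last first.
  by rewrite -big_distrr sum_subset_prod prodr_const.
apply: eq_bigr => D sDB; rewrite -big_distrr /= -big_mkcondr /=.
have sFDK : \bigcup_(v in D) F v \subset K.
  by apply/bigcupsP => v /(subsetP sDB); apply: sFK.
have cFD : #|\bigcup_(v in D) F v| = (k * #|D|)%N.
  by apply: card_bigcup_disjoint => [v|v w] /(subsetP sDB) => [|vB /(subsetP sDB)]; auto.
rewrite (eq_bigl (fun E => E \subset K :\: \bigcup_(v in D) F v)); last first.
  by move=> E; rewrite subsetD.
rewrite sum_subset_weight prodrN mulrCA prodr_const; congr (_ * _).
rewrite cardsD (setIidPr sFDK) cFD exprVn -exprM expfB_cond //.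
rewrite (negPf u0) add0n -cFD; exact: subset_leq_card.
Qed.

(** The weight is a product over the elements of [E], with factor [z * y] inside [F] and [y]
    outside. With [F] the star of a vertex this is the exponential moment of its degree. *)
Lemma sum_subset_weight2 K F y z : F \subset K ->
  \sum_(E : {set T} | E \subset K) y ^+ #|E| * z ^+ #|E :&: F|
    = (1 + y) ^+ (#|K| - #|F|) * (1 + z * y) ^+ #|F|.
Proof.
move=> sFK.
transitivity (\sum_(E : {set T} | E \subset K)
  \prod_(e in E) (if e \in F then z * y else y)).
  apply: eq_bigr => E _; rewrite -!prodr_const (big_setID F) /= [in RHS](big_setID F) /=.
  rewrite mulrC mulrA -big_split /=; congr (_ * _); apply: eq_bigr => e; rewrite inE.
    by case/andP => _ ->.
  by case/andP => /negPf->.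
rewrite sum_subset_prod (big_setID F) /= (setIidPr sFK) mulrC; congr (_ * _).
  rewrite (eq_bigr (fun=> 1 + y)) ?prodr_const ?cardsD ?(setIidPr sFK) // => e.
  by rewrite inE => /andP[/negPf-> _].
by rewrite (eq_bigr (fun=> 1 + z * y)) ?prodr_const // => e ->.
Qed.

(** Since [x <= 1], each set of size at most [w] contributes at least [x ^+ w] to the expansion of
    [(1 + x) ^+ #|T|]. *)
Lemma card_small_subsets w (x : R) : 0 <= x -> x <= 1 ->
  #|[set E : {set T} | (#|E| <= w)%N]|%:R * x ^+ w <= (1 + x) ^+ #|T|.
Proof.
move=> x0 x1; rewrite -cardsT -sum_subset_weight.
rewrite mulr_natl -sumr_const [leLHS]big_mkcond [leRHS]big_mkcond /=.
apply: ler_sum => E _; rewrite subsetT inE; case: ifP => // cE; last exact: exprn_ge0.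
by rewrite ler_wiXn2l.
Qed.

(** The ratio of term [i+1] to term [i] is [(N - i) m / ((i + 1) (N - m))], at least 1 for [i < m]
    and at most 1 for [i >= m]. The terms thus increase up to [m] and decrease afterwards. *)
Lemma binomial_term_le_mode N m j (y : R) : (m < N)%N -> y = m%:R / (N - m)%:R ->
  'C(N, j)%:R * y ^+ j <= 'C(N, m)%:R * y ^+ m.
Proof.
move=> mN y_def; pose t i := 'C(N, i)%:R * y ^+ i : R.
have Nm0 : 0 < (N - m)%:R :> R by rewrite ltr0n subn_gt0.
have y0 : 0 <= y by rewrite y_def divr_ge0 // ltW.
have tS i : i.+1%:R * t i.+1 = (N - i)%:R * y * t i.
  by rewrite /t mulrA -natrM mul_bin_left natrM exprS mulrACA.
have t0 i : 0 <= t i by rewrite /t mulr_ge0 ?exprn_ge0.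
have t_up i : (i < m)%N -> t i <= t i.+1.
  move=> im; rewrite -(ler_pM2l (ltr0Sn R i)) tS; apply: ler_wpM2r => //.
  rewrite y_def mulrA ler_pdivlMr // -!natrM ler_nat; nia.
have t_down i : (m <= i)%N -> t i.+1 <= t i.
  move=> im; rewrite -(ler_pM2l (ltr0Sn R i)) tS; apply: ler_wpM2r => //.
  rewrite y_def mulrA ler_pdivrMr // -!natrM ler_nat.
  have [iN|/ltnW Ni] := leqP i N; first by nia.
  by rewrite (eqP Ni) mul0n.
rewrite -/(t j) -/(t m); have [mj|/ltnW jm] := leqP m j.
  rewrite -(subnKC mj); elim: (j - m)%N => [|i IHi]; first by rewrite addn0.
  by rewrite addnS (le_trans (t_down _ _)) ?leq_addr.
rewrite -(subKn jm); elim: (m - j)%N => [|i IHi]; first by rewrite subn0.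
have [im|mi] := ltnP i m; last by rewrite (_ : m - i.+1 = m - i)%N //; lia.
apply: le_trans IHi; rewrite (_ : m - i = (m - i.+1).+1)%N; last by lia.
by apply: t_up; lia.
Qed.

(* The mode [m] carries at least a [1/(N+1)] fraction of the binomial sum, so a
   weighted count over all subsets controls the count over subsets of size [m]. *)
Lemma card_fixed_size_le K (P : pred {set T}) m y c :
  (0 < m < #|K|)%N -> y = m%:R / (#|K| - m)%:R -> 0 <= c ->
  \sum_(E : {set T} | (E \subset K) && P E) y ^+ #|E| <= c * (1 + y) ^+ #|K| ->
  #|[set E : {set T} | (E \subset K) && (#|E| == m) & P E]|%:R
    <= #|K|.+1%:R * 'C(#|K|, m)%:R * c.
Proof.
move=> /andP[m0 mK] y_def c0 le_sum.
have y0 : 0 < y by rewrite y_def divr_gt0 // ltr0n ?subn_gt0.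
rewrite -(ler_pM2r (exprn_gt0 m y0)).
apply: (@le_trans _ _ (c * (1 + y) ^+ #|K|)).
  apply: le_trans le_sum; rewrite mulr_natl -sumr_const.
  rewrite [leLHS]big_mkcond [leRHS]big_mkcond; apply: ler_sum => E _.
  rewrite !inE; case: (E \subset K) => //=; case: eqP => [->|_] /=; case: (P E) => //.
  by rewrite exprn_ge0 // ltW.
rewrite mulrAC mulrC ler_wpM2r // -mulrA exprDn.
under eq_bigr do rewrite expr1n mul1r.
under eq_bigr do rewrite -mulr_natl.
apply: le_trans (_ : \sum_(i < #|K|.+1) 'C(#|K|, m)%:R * y ^+ m <= _).
  apply: ler_sum => i _.
  exact: binomial_term_le_mode mK y_def.
by rewrite sumr_const card_ord -[leLHS]mulr_natl.
Qed.

End SubsetSums.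

(** * Counting bad graphs in G(n,m) *)

Section RandomGraph.
Import Order.TTheory GRing.Theory Num.Theory.
Local Open Scope ring_scope.
Variables (R : realFieldType) (n m : nat) (y : R).
Implicit Types (S W : {set 'I_n}) (E : {set {set 'I_n}}) (u v : 'I_n).
Hypothesis m_bounds : (0 < m < #|edges_Kn n|)%N.
Hypothesis y_def : y = m%:R / (#|edges_Kn n| - m)%:R.

Let y_ge0 : 0 <= y.
Proof. by rewrite y_def divr_ge0 ?ler0n. Qed.

Let u_ge1 : 1 <= 1 + y.
Proof. by rewrite lerDl. Qed.

Let u_gt0 : 0 < 1 + y.
Proof. exact: lt_le_trans u_ge1. Qed.

Lemma card_edges_Kn : #|edges_Kn n| = 'C(n, 2).
Proof.
rewrite -[in RHS](card_ord n) -card_draws; apply: eq_card => e; by rewrite !inE.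
Qed.

Lemma card_Gnm_space : #|Gnm_space n m| = 'C(#|edges_Kn n|, m).
Proof. exact: cards_draws. Qed.

Lemma card_Gnm_le (P : pred {set {set 'I_n}}) c : 0 <= c ->
  \sum_(E : {set {set 'I_n}} | (E \subset edges_Kn n) && P E) y ^+ #|E|
    <= c * (1 + y) ^+ #|edges_Kn n| ->
  #|[set E in Gnm_space n m | P E]|%:R <= #|edges_Kn n|.+1%:R * #|Gnm_space n m|%:R * c.
Proof.
move=> c0 le_sum; rewrite card_Gnm_space.
apply: le_trans (card_fixed_size_le m_bounds y_def c0 le_sum).
by rewrite ler_nat subset_leq_card //; apply/subsetP => E; rewrite !inE.
Qed.

Definition star v S : {set {set 'I_n}} := [set [set v; u] | u in S].

Lemma pair_inj v u w : [set v; u] = [set v; w] -> u = w.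
Proof.
move=> eq_vu; have /set2P[uv|//] : u \in [set v; w] by rewrite -eq_vu set22.
by have /set2P[->|->] : w \in [set v; u] by rewrite eq_vu set22.
Qed.

Lemma card_star v S : #|star v S| = #|S|.
Proof. by rewrite card_imset // => u w; apply: pair_inj. Qed.

Lemma star_sub_edges v S : v \notin S -> star v S \subset edges_Kn n.
Proof.
move=> vS; apply/subsetP => e /imsetP[u uS ->]; rewrite inE cards2.
by case: (eqVneq v u) vS => // ->; rewrite uS.
Qed.

(** A common edge would contain both [v] and [w], forcing [v] into [S]. This is the disjointness
    that [sum_subset_hitting] asks for. *)
Lemma star_disjoint S v w :
  v \notin S -> w \notin S -> v != w -> [disjoint star v S & star w S].
Proof.
move=> vS wS vw; apply/pred0P => e /=; apply/negP => /andP[/imsetP[u uS ->]].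
move=> /imsetP[x xS /setP/(_ v)]; rewrite !inE eqxx (negPf vw) /= => /esym/eqP vx.
by rewrite vx xS in vS.
Qed.

Lemma meets_neighboursE E v S :
  [disjoint neighbours E v & S] = [disjoint E & star v S].
Proof.
apply/pred0P/pred0P => [dis e|dis u] /=; apply/negP => /andP[].
  by move=> eE /imsetP[u uS e_def]; have := dis u; rewrite /= inE uS -e_def eE.
by rewrite inE => uE uS; have := dis [set v; u]; rewrite /= uE (imset_f (fun w => [set v; w]) uS).
Qed.

(** The event says that every vertex outside [S :|: W] has a neighbour in [S], i.e. that [E] hits
    each of the disjoint stars from these vertices to [S]. *)
Lemma card_Gnm_isolated_sub S W :
  #|[set E in Gnm_space n m | isolated_from E S \subset W]|%:R
    <= #|edges_Kn n|.+1%:R * #|Gnm_space n m|%:R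
       * (1 - (1 + y) ^- #|S|) ^+ #|~: (S :|: W)|.
Proof.
have q1 : 0 <= 1 - (1 + y) ^- #|S| by rewrite subr_ge0 invf_le1 ?exprn_ege1 ?exprn_gt0.
apply: card_Gnm_le; first exact: exprn_ge0.
rewrite mulrC -(@sum_subset_hitting _ _ _ _ (star^~ S)) //.
- rewrite le_eqVlt; apply/orP; left; apply/eqP; apply: eq_bigl => E; congr (_ && _).
  apply/subsetP/forall_inP => [isoW v|hit v].
    rewrite !inE negb_or -meets_neighboursE => /andP[vS]; apply: contra => dv.
    by apply: isoW; rewrite inE vS.
  rewrite inE meets_neighboursE => /andP[vS]; apply: contraLR => vW; apply: hit.
  by rewrite !inE negb_or vS.
- by move=> v; rewrite !inE negb_or => /andP[vS _]; apply: star_sub_edges.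
- by move=> v _; apply: card_star.
- by move=> v w; rewrite !inE !negb_or => /andP[? _] /andP[? _]; apply: star_disjoint.
Qed.

(** Markov's inequality for [z] to the power of the degree of [v], a vertex being in fewer than [n]
    pairs. *)
Lemma card_Gnm_degree_ge v r (z : R) : 1 <= z ->
  #|[set E in Gnm_space n m | (r <= #|neighbours E v|)%N]|%:R
    <= #|edges_Kn n|.+1%:R * #|Gnm_space n m|%:R * (z ^- r * (1 + z * y) ^+ n).
Proof.
move=> z1; have z0 : 0 < z by apply: lt_le_trans z1.
have zy1 : 1 <= 1 + z * y by rewrite lerDl mulr_ge0 // ltW.
apply: card_Gnm_le.
  by rewrite mulr_ge0 ?invr_ge0 ?exprn_ge0 ?(le_trans ler01) // ltW.
pose F := star v (~: [set v]).
have sF : F \subset edges_Kn n by apply: star_sub_edges; rewrite !inE eqxx.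
have cF : (#|F| <= n)%N by rewrite card_star -[leqRHS]card_ord max_card.
rewrite -mulrA ler_pdivlMl ?exprn_gt0 //.
apply: (@le_trans _ _ ((1 + y) ^+ (#|edges_Kn n| - #|F|) * (1 + z * y) ^+ #|F|)).
  rewrite -sum_subset_weight2 // big_distrr /= big_mkcondr /=; apply: ler_sum => E sE.
  case: ifP => [rE|_]; last by rewrite mulr_ge0 ?exprn_ge0 // ltW.
  rewrite mulrC ler_wpM2l ?exprn_ge0 // ler_weXn2l //.
  apply: leq_trans rE _; rewrite -(card_star v); apply: subset_leq_card.
  apply/subsetP => e /imsetP[u uv ->]; rewrite inE; move: (uv); rewrite inE => -> /=.
  apply: imset_f; rewrite !inE; apply: contraTneq uv => ->; exact: neighbours_irr.
rewrite mulrC ler_pM ?exprn_ge0 ?(le_trans ler01) //.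
  by rewrite ler_weXn2l.
by rewrite ler_weXn2l // leq_subr.
Qed.

(** The failure of one of the two quantitative hypotheses of [gamma_connected_of_isolated]. *)
Definition bad_graph k r E : bool :=
  [exists S : {set 'I_n}, (#|S| == k) && (#|isolated_from E S| < r * r)%N]
  || [exists v, (r <= #|neighbours E v|)%N].

(** A union bound over pairs [S], [W], where [W] stands for the small set of isolated vertices, and
    over vertices of large degree. Both families of sets are counted by [card_small_subsets] with
    the same [x], whence the exponents [k + r * r] and [n + n]. *)
Lemma card_Gnm_bad k r (x z : R) : 0 < x -> x <= 1 -> 1 <= z ->
  #|[set E in Gnm_space n m | bad_graph k r E]|%:R
    <= #|edges_Kn n|.+1%:R * #|Gnm_space n m|%:R
       * (x ^- (k + r * r) * (1 + x) ^+ (n + n) * (1 - (1 + y) ^- k) ^+ (n - (k + r * r))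
          + n%:R * (z ^- r * (1 + z * y) ^+ n)).
Proof.
move=> x0 x1 z1; set q := 1 - _; set C := _ * _%:R.
have q0 : 0 <= q by rewrite subr_ge0 invf_le1 ?exprn_ege1 ?exprn_gt0.
have q1 : q <= 1 by rewrite lerBlDr lerDl invr_ge0 exprn_ge0 // ltW.
have C0 : 0 <= C by rewrite mulr_ge0.
pose A1 := \bigcup_(S in [set S : {set 'I_n} | #|S| == k])
   \bigcup_(W in [set W : {set 'I_n} | (#|W| <= r * r)%N])
   [set E in Gnm_space n m | isolated_from E S \subset W].
pose A2 := \bigcup_v [set E in Gnm_space n m | (r <= #|neighbours E v|)%N].
have sub_bad : [set E in Gnm_space n m | bad_graph k r E] \subset A1 :|: A2.
  apply/subsetP => E; rewrite inE => /andP[EG /orP[]] /existsP[].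
    move=> S /andP[cS isoS]; rewrite inE; apply/orP; left.
    apply/bigcupP; exists S; first by rewrite inE.
    apply/bigcupP; exists (isolated_from E S); first by rewrite inE ltnW.
    by rewrite inE EG /=.
  move=> v rv; rewrite inE; apply/orP; right; apply/bigcupP; exists v => //.
  by rewrite inE EG.
have card_bigcup (U : finType) (D : {pred U}) (G : U -> {set {set {set 'I_n}}}) :
    #|\bigcup_(i in D) G i|%:R <= \sum_(i in D) #|G i|%:R :> R.
  rewrite -natr_sum ler_nat; elim/big_ind2: _ => [|a A b B leA leB|//].
    by rewrite cards0.
  by apply: leq_trans (leq_card_setU _ _) _; rewrite leq_add.
apply: le_trans (_ : (#|A1| + #|A2|)%:R <= _).
  by rewrite ler_nat (leq_trans (subset_leq_card sub_bad)) // leq_card_setU.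
rewrite natrD mulrDr; apply: lerD.
  have card_le w : #|[set S : {set 'I_n} | (#|S| <= w)%N]|%:R <= x ^- w * (1 + x) ^+ n.
    have := @card_small_subsets R 'I_n w x (ltW x0) x1; rewrite card_ord.
    by rewrite -ler_pdivlMr ?exprn_gt0 // mulrC.
  pose c := C * q ^+ (n - (k + r * r)).
  apply: le_trans (_ : #|[set S : {set 'I_n} | (#|S| <= k)%N]|%:R *
    (#|[set W : {set 'I_n} | (#|W| <= r * r)%N]|%:R * c) <= _); last first.
    rewrite mulrA /c [leRHS](_ : _ = (x ^- k * (1 + x) ^+ n) * (x ^- (r * r) * (1 + x) ^+ n) *
        (C * q ^+ (n - (k + r * r)))).
      by rewrite ler_wpM2r ?mulr_ge0 ?exprn_ge0 // ler_pM.
    by rewrite !exprD invfM mulrCA; congr (_ * _); apply: mulrACA.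
  apply: le_trans (card_bigcup _ _ _) _.
  apply: le_trans (_ : \sum_(S in [set S : {set 'I_n} | #|S| == k])
     (#|[set W : {set 'I_n} | (#|W| <= r * r)%N]|%:R * c) <= _).
    apply: ler_sum => S; rewrite inE => /eqP cS.
    apply: le_trans (card_bigcup _ _ _) _; rewrite mulr_natl -sumr_const.
    apply: ler_sum => W; rewrite inE => cW.
    apply: le_trans (card_Gnm_isolated_sub S W) _; rewrite cS -/C -/q.
    apply: ler_wpM2l => //; apply: ler_wiXn2l => //.
    rewrite cardsCs setCK card_ord leq_sub2l //.
    by apply: leq_trans (leq_card_setU _ _) _; rewrite cS leq_add2l.
  rewrite sumr_const -[leLHS]mulr_natl ler_wpM2r ?mulr_ge0 ?exprn_ge0 // ler_nat.
  by apply: subset_leq_card; apply/subsetP => S; rewrite !inE => /eqP->.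
apply: le_trans (card_bigcup _ _ _) _.
apply: le_trans (_ : \sum_(v : 'I_n) C * (z ^- r * (1 + z * y) ^+ n) <= _).
  by apply: ler_sum => v _; apply: card_Gnm_degree_ge.
by rewrite sumr_const card_ord -[leLHS]mulr_natl mulrCA.
Qed.

End RandomGraph.

(** * Numerical estimates over the Stdlib reals *)

Section Estimates.
Local Open Scope R_scope.

Lemma INR_leq (a b : nat) : (a <= b)%N -> INR a <= INR b.
Proof. by move=> ab; apply: le_INR; apply/leP. Qed.

Lemma INR_subn_ge (a b : nat) : INR a - INR b <= INR (a - b)%N.
Proof.
have : INR a <= INR (b + (a - b)%N) by apply: INR_leq; lia.
by rewrite plus_INR; lra.
Qed.

Lemma exp_INR_mul (k : nat) (t : R) : exp (INR k * t) = exp t ^ k.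
Proof.
elim: k => [|k IHk]; first by rewrite Rmult_0_l exp_0.
rewrite S_INR Rmult_plus_distr_r Rmult_1_l exp_plus IHk /=; ring.
Qed.

Lemma exp_le_compat (a b : R) : a <= b -> exp a <= exp b.
Proof. by case=> [/exp_increasing/Rlt_le|->]; lra. Qed.

Lemma one_plus_pow_le_exp (k : nat) (t : R) : -1 <= t -> (1 + t) ^ k <= exp (INR k * t).
Proof.
move=> t1; rewrite exp_INR_mul; apply: pow_incr; split; first lra.
exact: exp_ineq1_le.
Qed.

Lemma pow_le_exp (k : nat) (t : R) : 0 <= t -> t ^ k <= exp (INR k * t).
Proof.
move=> t0; rewrite exp_INR_mul; apply: pow_incr; split => //.
by have := exp_ineq1_le t; lra.
Qed.

Lemma INR_card_edges_Kn (n : nat) :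
  (0 < n)%N -> INR #|edges_Kn n| = INR n * (INR n - 1) / 2.
Proof.
case: n => // n _.
have : INR (#|edges_Kn n.+1| * 2)%N = INR (n.+1 * n)%N.
  by congr INR; rewrite card_edges_Kn bin2 /= muln2 -[RHS]odd_double_half oddM /= andNb.
by rewrite !mult_INR !S_INR /=; lra.
Qed.

Lemma m_of_bounds (d : R) (n : nat) : 0 < d ->
  d * INR n / 2 - 1 < INR (m_of d n) <= d * INR n / 2.
Proof.
move=> d0; set a := d * INR n / 2.
have a0 : 0 <= a by rewrite /a; have := pos_INR n; nra.
have [ub lb] := base_Int_part a.
have z0 : Z.le 0 (Int_part a).
  suff: (Z.lt (-1) (Int_part a)) by lia.
  by apply: lt_IZR; lra.
rewrite /m_of -/a INR_IZR_INZ Znat.Z2Nat.id //; lra.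
Qed.

Lemma INR_card_Gnm_bad (n m k r : nat) (y x z : R) :
  (0 < m < #|edges_Kn n|)%N -> y = INR m / (INR #|edges_Kn n| - INR m) ->
  0 < x <= 1 -> 1 <= z ->
  INR #|[set E in Gnm_space n m | bad_graph k r E]|
    <= (INR #|edges_Kn n| + 1) * INR #|Gnm_space n m| *
       (/ x ^ (k + r * r) * (1 + x) ^ (n + n) * (1 - / (1 + y) ^ k) ^ (n - (k + r * r))
        + INR n * (/ z ^ r * (1 + z * y) ^ n)).
Proof.
move=> mN y_def [/RltP x0 /RleP x1] /RleP z1.
have mle : (m <= #|edges_Kn n|)%N by case/andP: mN => _ /ltnW.
have y_def' : y = (m%:R / (#|edges_Kn n| - m)%:R)%R.
  by rewrite y_def GRing.natrB // !INRE.
apply/RleP; have := card_Gnm_bad mN y_def' k r x0 x1 z1.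
by rewrite -S_INR !INRE !RpowE.
Qed.

(** The choice [z = e]; the exponent [6 * d] comes from [e <= 3] and [n y <= 2 d]. *)
Lemma degree_term_le (n r : nat) (d t y : R) :
  0 < d -> 0 <= y -> INR n * y <= 2 * d -> t <= INR r ->
  / exp 1 ^ r * (1 + exp 1 * y) ^ n <= exp (6 * d) * exp (- t).
Proof.
move=> d0 y0 ny tr; have e0 := exp_pos 1; have e3 := exp_le_3.
rewrite -exp_INR_mul Rmult_1_r -exp_Ropp Rmult_comm.
apply: Rmult_le_compat; try exact: Rlt_le (exp_pos _).
- by apply: pow_le; nra.
- apply: Rle_trans (one_plus_pow_le_exp _ _) _; first by nra.
  by apply: exp_le_compat; have := pos_INR n; nra.
- by apply: exp_le_compat; lra.
Qed.

Lemma exp_ge_4 (L : R) : 16 <= L -> 4 * L <= exp L.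
Proof.
move=> L16; have := @pow_le_exp 2 (L / 2); rewrite (_ : INR 2 * (L / 2) = L) /=; last by field.
by move=> /(_ ltac:(lra)); nra.
Qed.

(** From [(s / 6) ^ 6 <= exp s]: the two extra powers of [s] absorb [6 ^ 6], the factor [e] and the
    coefficients on the left. *)
Lemma exp_ge_quartic (s : R) : 10 ^ 5 <= s -> 6 * s ^ 4 + 8 <= exp (s - 1).
Proof.
move=> s5; have s0 : 0 <= s by lra.
have := @pow_le_exp 6 (s / 6) ltac:(lra).
rewrite (_ : INR 6 * (s / 6) = (s - 1) + 1); last by rewrite /=; field.
rewrite exp_plus; have := exp_le_3; have := exp_pos (s - 1); have e0 := exp_pos 1.
set X := exp (s - 1) => X0 e3 le6.
have le6' : (s / 6) ^ 6 <= X * 3 by nra.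
have s2 : 10 ^ 10 <= s ^ 2 by rewrite /=; nra.
have s4 : 10 ^ 10 <= s ^ 4 by rewrite (_ : s ^ 4 = s ^ 2 * s ^ 2); [nra | ring].
have s6 : 10 ^ 10 * s ^ 4 <= (s / 6) ^ 6 * 6 ^ 6.
  by rewrite (_ : _ * 6 ^ 6 = s ^ 2 * s ^ 4); [nra | field].
lra.
Qed.

(** Here [s] is the square root of [ln d] and [x = 1 / d]. With [a = n / d], the first two factors
    cost [exp (2 s^4 a + 2 a)], while the last gains [exp (- a X / 2)] with [X = exp (s - 1)] at
    least [6 s^4 + 8]. *)
Lemma isolated_term_le (n k r : nat) (d s y : R) :
  10 ^ 5 <= s -> d = exp (s ^ 2) ->
  INR k <= (1 - / s) * (s ^ 2 / d) * INR n -> INR (r * r) <= s ^ 2 / d * INR n ->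
  0 <= y -> INR n * y * s ^ 2 <= d * (s ^ 2 + 1) ->
  / (/ d) ^ (k + r * r) * (1 + / d) ^ (n + n) * (1 - / (1 + y) ^ k) ^ (n - (k + r * r))
    <= exp (- (INR n / d)).
Proof.
move=> s5 d_def kn rn y0 ny.
have s0 : 0 < s by lra.
have d0 : 0 < d by rewrite d_def; apply: exp_pos.
have is0 : 0 < / s by apply: Rinv_0_lt_compat.
have is1 : / s <= 1 by rewrite -Rinv_1; apply: Rinv_le_contravar; lra.
have s2 : 10 ^ 10 <= s ^ 2 by rewrite /=; nra.
have d4 : 4 * s ^ 2 <= d by rewrite d_def; apply: exp_ge_4; lra.
set a := INR n / d.
have n_def : INR n = a * d by rewrite /a; field; lra.
have a0 : 0 <= a by rewrite /a; apply: Rmult_le_pos; [exact: pos_INR |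
  exact/Rlt_le/Rinv_0_lt_compat].
have kn' : INR k <= (1 - / s) * (s ^ 2 * a).
  by apply: Rle_trans kn _; right; rewrite /a; field; lra.
have rn' : INR (r * r) <= s ^ 2 * a.
  by apply: Rle_trans rn _; right; rewrite /a; field; lra.
have k0 := pos_INR k; have r0 := pos_INR (r * r)%N.
have sa0 : 0 <= s ^ 2 * a by nra.
have knr : INR (k + r * r)%N <= 2 * s ^ 2 * a by rewrite plus_INR; nra.
have le1 : / (/ d) ^ (k + r * r) <= exp (2 * s ^ 4 * a).
  rewrite pow_inv Rinv_inv d_def -exp_INR_mul; apply: exp_le_compat.
  rewrite (_ : 2 * s ^ 4 * a = 2 * s ^ 2 * a * s ^ 2); last by ring.
  by apply: Rmult_le_compat_r; lra.
have id0 : 0 < / d by apply: Rinv_0_lt_compat.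
have le2 : (1 + / d) ^ (n + n) <= exp (2 * a).
  apply: Rle_trans (one_plus_pow_le_exp _ _) _; first by lra.
  by apply: exp_le_compat; right; rewrite plus_INR /a; field; lra.
(* The relative deficit [1 / s] in [k] saves [s] in the exponent, so that [(1 + y) ^ - k] is at
   least [exp (s - 1) / d] rather than of order [1 / d]. *)
have ky : INR k * y <= s ^ 2 + 1 - s.
  apply: Rle_trans (_ : (1 - / s) * (s ^ 2 + 1) <= _); last first.
    rewrite (_ : (1 - / s) * (s ^ 2 + 1) = s ^ 2 + 1 - s - / s); [lra | field; lra].
  apply: Rle_trans (_ : (1 - / s) * (s ^ 2 * a) * y <= _); first by apply: Rmult_le_compat_r.
  rewrite Rmult_assoc; apply: Rmult_le_compat_l; first by lra.
  apply: (Rmult_le_reg_l d) => //; rewrite n_def in ny; lra.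
set q := / (1 + y) ^ k; set X := exp (s - 1).
have pk0 : 0 < (1 + y) ^ k by apply: pow_lt; lra.
have pk1 : 1 <= (1 + y) ^ k by apply: pow_R1_Rle; lra.
have q1 : q <= 1 by rewrite /q -[X in _ <= X]Rinv_1; apply: Rinv_le_contravar; lra.
have qX : X * / d <= q.
  rewrite /q /X d_def -exp_Ropp -exp_plus (_ : s - 1 + - s ^ 2 = - (s ^ 2 + 1 - s)); last by ring.
  rewrite exp_Ropp; apply: Rinv_le_contravar => //.
  by apply: Rle_trans (one_plus_pow_le_exp _ _) (exp_le_compat ky); lra.
have X8 : 6 * s ^ 4 + 8 <= X by apply: exp_ge_quartic.
have s4 : 0 <= s ^ 4 by apply: pow_le; lra.
(* [k + r * r] is at most [2 s^2 n / d], which is at most [n / 2] because [4 s^2 <= d]. *)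
have Mn : INR n / 2 <= INR (n - (k + r * r)).
  have := INR_subn_ge n (k + r * r).
  have := Rmult_le_compat_r a _ _ a0 d4; rewrite n_def; lra.
have le3 : (1 - q) ^ (n - (k + r * r)) <= exp (- (a / 2 * X)).
  apply: Rle_trans (one_plus_pow_le_exp _ _) _; first by lra.
  apply: exp_le_compat; rewrite Ropp_mult_distr_r_reverse; apply: Ropp_le_contravar.
  rewrite (_ : a / 2 * X = INR n / 2 * (X * / d)); last by rewrite n_def; field; lra.
  have Xd : 0 <= X * / d by apply: Rmult_le_pos; lra.
  by apply: Rmult_le_compat => //; rewrite n_def; nra.
apply: Rle_trans (_ : exp (2 * s ^ 4 * a) * exp (2 * a) * exp (- (a / 2 * X)) <= _).
  apply: Rmult_le_compat => //.
  - apply: Rmult_le_pos; last by apply: pow_le; lra.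
    by apply/Rlt_le/Rinv_0_lt_compat/pow_lt.
  - by apply: pow_le; lra.
  - apply: Rmult_le_compat => //; last by apply: pow_le; lra.
    by apply/Rlt_le/Rinv_0_lt_compat/pow_lt.
rewrite -!exp_plus; apply: exp_le_compat; nra.
Qed.

(** * Limits in n and the probability of connectedness *)

Lemma eventually_INR_ge (X : R) : exists n0, forall n, (n0 <= n)%N -> X <= INR n.
Proof.
have [n0 n0X] := INR_unbounded X.
by exists n0 => n /INR_leq; lra.
Qed.

Lemma whp_of_rate (p : nat -> R) (C : R) (n0 : nat) :
  (forall n, (n0 <= n)%N -> 1 - C / INR n <= p n <= 1) -> whp p.
Proof.
move=> bnd e e0; have [n1 n1P] := eventually_INR_ge (Rmax 1 (C / e) + 1).
have x1 := Rmax_l 1 (C / e); have xC := Rmax_r 1 (C / e).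
exists (maxn n0 n1) => n; rewrite geq_max => /andP[/bnd[lo hi] /n1P xn].
have n_gt0 : 0 < INR n by lra.
suff Ce : C / INR n < e by apply: Rabs_def1; lra.
apply: (Rmult_lt_reg_r (INR n)) => //.
rewrite (_ : C / INR n * INR n = C / e * e); last by field; lra.
by rewrite (Rmult_comm e); apply: Rmult_lt_compat_r; lra.
Qed.

Lemma prob_Gnm_ge (n m : nat) (P : {set {set 'I_n}} -> Prop)
    (bad : pred {set {set 'I_n}}) (b : R) :
  (0 < #|Gnm_space n m|)%N ->
  (forall E, E \in Gnm_space n m -> ~~ bad E -> P E) ->
  INR #|[set E in Gnm_space n m | bad E]| <= b * INR #|Gnm_space n m| ->
  1 - b <= prob_Gnm m P <= 1.
Proof.
move=> G0 badP bad_le; rewrite /prob_Gnm.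
set g := #|[set E in Gnm_space n m | Defs.decP (P E)]|.
set h := #|[set E in Gnm_space n m | bad E]| in bad_le.
have g0 : 0 < INR #|Gnm_space n m| by apply: lt_0_INR; apply/ltP.
have gle : INR g <= INR #|Gnm_space n m|.
  by apply: INR_leq; apply: subset_leq_card; apply/subsetP => E; rewrite inE => /andP[].
have gge : INR #|Gnm_space n m| <= INR g + INR h.
  rewrite -plus_INR; apply: INR_leq; apply: leq_trans (leq_card_setU _ _).
  apply: subset_leq_card; apply/subsetP => E EG; apply/setUP.
  case: (boolP (bad E)) => [bE|/(badP E EG) PE]; [right | left]; apply/setIdP; split=> //.
  by rewrite /Defs.decP; case: excluded_middle_informative.
split; apply: (Rmult_le_reg_r _ _ _ g0).
  by rewrite /Rdiv Rmult_assoc Rinv_l; lra.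
by rewrite /Rdiv Rmult_assoc Rinv_l; lra.
Qed.

Lemma exists_nat_near (t : R) : 1 <= t -> exists r : nat, t <= INR r /\ INR (r * r) <= 4 * (t * t).
Proof.
move=> t1; have [lo hi] := archimed t.
have r_def : INR (Z.to_nat (up t)) = IZR (up t).
  by rewrite INR_IZR_INZ Znat.Z2Nat.id //; apply: le_IZR; lra.
exists (Z.to_nat (up t)); rewrite mult_INR r_def; split; first lra.
by apply: Rle_trans (_ : (2 * t) * (2 * t) <= _); [apply: Rmult_le_compat; lra | lra].
Qed.

(** From [(t / 8) ^ 8 <= exp t] and [t ^ 8 = (x / d) ^ 4]. It lets [exp (- sqrt (n / d))] beat the
    polynomial factors of the union bound. *)
Lemma exp_sqrt_decay (d x t : R) : 0 < d -> 0 < x -> 0 < t -> t * t = x / d ->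
  x ^ 4 * exp (- t) <= 8 ^ 8 * d ^ 4.
Proof.
move=> d0 x0 t0 tt; have := @pow_le_exp 8 (t / 8) ltac:(lra).
rewrite (_ : INR 8 * (t / 8) = t); last by rewrite /=; field.
have et := exp_pos t.
rewrite exp_Ropp => le8; apply: (Rmult_le_reg_r (exp t)) => //.
rewrite Rmult_assoc Rinv_l; last by lra.
have -> : x = (t * t) * d by rewrite tt; field; lra.
have d4 : 0 <= 8 ^ 8 * d ^ 4 by apply: Rmult_le_pos; apply: pow_le; lra.
have := Rmult_le_compat_l _ _ _ d4 le8.
by apply: Rle_trans; right; field.
Qed.

Lemma prob_Gnm_connected_ge (n k : nat) (d s : R) :
  10 ^ 5 <= s -> d = exp (s ^ 2) -> (s ^ 2 + 1) * (1 + d) + d + 2 <= INR n ->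
  INR k <= (1 - / s) * (s ^ 2 / d) * INR n ->
  1 - (2 * exp (6 * d) * (8 ^ 8 * d ^ 4)) / INR n
    <= prob_Gnm (m_of d n) (fun E : {set {set 'I_n}} => gamma_connected (Sk E k) 2) <= 1.
Proof.
move=> s5 d_def nbig kn.
have s0 : 0 < s by lra.
have s2 : 10 ^ 10 <= s ^ 2 by rewrite /=; nra.
have d4 : 4 * s ^ 2 <= d by rewrite d_def; apply: exp_ge_4; lra.
have nd : d + 2 <= INR n by nra.
have n_gt0 : (0 < n)%N by apply/ltP/INR_lt; rewrite /=; lra.
have [mlo mhi] := @m_of_bounds d n ltac:(lra).
set m := m_of d n in mlo mhi *.
have N_def := INR_card_edges_Kn n_gt0.
have m_gt0 : 0 < INR m by nra.
have mN : INR m < INR #|edges_Kn n| by rewrite N_def; nra.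
have m_bnd : (0 < m < #|edges_Kn n|)%N.
  by apply/andP; split; apply/ltP/INR_lt.
set t := sqrt (INR n / d).
have nd1 : 1 <= INR n / d.
  by apply: (Rmult_le_reg_r d); first lra; rewrite /Rdiv Rmult_assoc Rinv_l; lra.
have t1 : 1 <= t by rewrite /t -sqrt_1; apply: sqrt_le_1_alt.
have tt : t * t = INR n / d by apply: sqrt_sqrt; lra.
have [r [tr rt]] := exists_nat_near t1.
set y := INR m / (INR #|edges_Kn n| - INR m).
have y0 : 0 <= y by apply: Rmult_le_pos; [lra | apply/Rlt_le/Rinv_0_lt_compat; lra].
(* As [m <= d n / 2], the difference of [#|edges_Kn n|] and [m] is at least [n (n - 1 - d) / 2]. *)
have ny : INR n * y * (INR n - 1 - d) <= d * INR n.
  have y_eq : y * (INR #|edges_Kn n| - INR m) = INR m by rewrite /y; field; lra.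
  nra.
(* This needs [s^2 n <= (s^2 + 1) (n - 1 - d)], i.e. the term [(s^2 + 1) (1 + d)] of the lower bound
   on [n]. *)
have ny1 : INR n * y * s ^ 2 <= d * (s ^ 2 + 1).
  nra.
have ny2 : INR n * y <= 2 * d by nra.
have e1 : 1 <= exp 1 by have := exp_ineq1_le 1; lra.
have id : 0 < / d <= 1.
  split; first by apply: Rinv_0_lt_compat; lra.
  by rewrite -[X in _ <= X]Rinv_1; apply: Rinv_le_contravar; lra.
have rn : INR (r * r) <= s ^ 2 / d * INR n.
  apply: Rle_trans rt _; rewrite tt
    (_ : s ^ 2 / d * INR n = s ^ 2 * (INR n / d)); last by field; lra.
  by apply: Rmult_le_compat_r; lra.
apply: (@prob_Gnm_ge _ _ _ (bad_graph k r)).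
- by rewrite card_Gnm_space bin_gt0 ltnW //; case/andP: m_bnd.
- move=> E; rewrite inE => /andP[sE _]; rewrite negb_or !negb_exists.
  move=> /andP[/forallP noS /forallP noV].
  apply: (gamma_connected_of_isolated (r := r)) => // [v|S cS]; first by rewrite ltnNge.
  by have := noS S; rewrite cS eqxx /= -leqNgt.
apply: Rle_trans (INR_card_Gnm_bad k r m_bnd erefl id e1) _.
rewrite -/y Rmult_assoc Rmult_comm Rmult_assoc Rmult_comm.
apply: Rmult_le_compat_r; first exact: pos_INR.
have T1 := isolated_term_le s5 d_def kn rn y0 ny1.
have T2 := @degree_term_le n r d t y ltac:(lra) y0 ny2 tr.
have et := exp_pos (- t).
have T1' : exp (- (INR n / d)) <= exp (- t) by apply: exp_le_compat; rewrite -tt; nra.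
have e6 : 1 <= exp (6 * d) by have := exp_ineq1_le (6 * d); lra.
have N2 : INR #|edges_Kn n| + 1 <= INR n ^ 2 by rewrite N_def /=; nra.
have n1 : 1 <= INR n by lra.
set A := _ + INR n * _.
have leA : A <= INR n * (2 * exp (6 * d) * exp (- t)).
  apply: Rle_trans (_ : exp (- t) + INR n * (exp (6 * d) * exp (- t)) <= _).
    apply: Rplus_le_compat; first by lra.
    by apply: Rmult_le_compat_l; lra.
  have h1 : 1 * exp (- t) <= INR n * exp (6 * d) * exp (- t).
    by apply: Rmult_le_compat_r; [lra | nra].
  lra.
have dec := @exp_sqrt_decay d (INR n) t ltac:(lra) ltac:(lra) ltac:(lra) tt.
have A0 : 0 <= INR n * (2 * exp (6 * d) * exp (- t)).
  by apply: Rmult_le_pos; [lra | apply: Rmult_le_pos; lra].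
have N0 := pos_INR #|edges_Kn n|.
rewrite Rmult_comm.
(* The factor [n ^ 2] pays for the passage to G(n,m) and [n] for the union over vertices; a fourth
   power of [n] leaves the rate [1 / n]. *)
apply: Rle_trans (_ : INR n ^ 2 * (INR n * (2 * exp (6 * d) * exp (- t))) <= _).
  apply: Rle_trans (_ : (INR #|edges_Kn n| + 1) * (INR n * (2 * exp (6 * d) * exp (- t))) <= _).
    by apply: Rmult_le_compat_l; lra.
  by apply: Rmult_le_compat_r; lra.
apply: (Rmult_le_reg_r (INR n)); first lra.
rewrite [X in _ <= X](_ : _ = 2 * exp (6 * d) * (8 ^ 8 * d ^ 4)); last by field; lra.
rewrite [X in X <= _](_ : _ = 2 * exp (6 * d) * (INR n ^ 4 * exp (- t))); last by ring.
by apply: Rmult_le_compat_l; lra.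
Qed.

(** No graph is bad; [d + 1 <= n] only ensures that [Gnm_space] is nonempty. The form [0 / INR n]
    fits [whp_of_rate]. *)
Lemma prob_Gnm_Sk0_ge (n : nat) (d : R) : 0 < d -> d + 1 <= INR n ->
  1 - 0 / INR n
    <= prob_Gnm (m_of d n) (fun E : {set {set 'I_n}} => gamma_connected (Sk E 0) 2) <= 1.
Proof.
move=> d0 nd; rewrite /Rdiv Rmult_0_l.
have n_gt0 : (0 < n)%N by apply/ltP/INR_lt; rewrite /=; lra.
apply: (@prob_Gnm_ge _ _ _ pred0).
- rewrite card_Gnm_space bin_gt0; apply/leP/INR_le; rewrite INR_card_edges_Kn //.
  by have [_ mhi] := m_of_bounds n d0; nra.
- by move=> E _ _; apply: gamma_connected_Sk0.
rewrite (eq_card0 (_ : _ =i pred0)); last by move=> E; rewrite !inE andbF.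
by rewrite Rmult_0_l /=; lra.
Qed.

End Estimates.

(** * Choice of [eps] and conclusion *)

Open Scope R_scope.

Theorem theorem1p1 :
  exists eps : R -> R,
    (forall e : R, (0 < e) -> exists D : R, forall d : R, (D <= d) ->
        (Rabs (eps d) < e)) /\
    forall d : R, (0 < d) ->
      exists gamma : nat,
        forall k : nat -> nat,
          (forall n : nat,
              (INR (k n) <= (1 - eps d) * (ln d / d) * INR n)) ->
          whp (fun n => @prob_Gnm n (m_of d n)
                          (fun E => gamma_connected (Sk E (k n)) gamma)).
Proof.
exists (fun d => if Rle_dec (10 ^ 5) (sqrt (ln d)) then / sqrt (ln d) else 1); split.
  move=> e e0; set b := Rmax (10 ^ 5) (/ e + 1).
  have b1 := Rmax_l (10 ^ 5) (/ e + 1); have b2 := Rmax_r (10 ^ 5) (/ e + 1).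
  rewrite -/b in b1 b2; have ie := Rinv_0_lt_compat e e0.
  (* Beyond this threshold [sqrt (ln d)] is at least [b], which exceeds both [10 ^ 5] (up to
     equality) and [/ e]. *)
  exists (exp (b * b)) => d dge.
  have sge : b <= sqrt (ln d).
    rewrite -(sqrt_square b); last by lra.
    apply: sqrt_le_1_alt; rewrite -(ln_exp (b * b)).
    by case: dge => [lt|->]; [apply/Rlt_le/ln_increasing => //; apply: exp_pos | lra].
  case: (Rle_dec (10 ^ 5) _) => [s5|]; last by case; lra.
  rewrite Rabs_pos_eq; last by apply/Rlt_le/Rinv_0_lt_compat; lra.
  by rewrite -(Rinv_inv e); apply: Rinv_lt_contravar; [apply: Rmult_lt_0_compat | ]; lra.
move=> d d0; exists 2%N => k; case: (Rle_dec (10 ^ 5) (sqrt (ln d))) => [s5|nle] /= kn.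
  have L0 : 0 < ln d.
    (* [sqrt] takes the value 0 on nonpositive reals, so a large [sqrt (ln d)] forces [ln d > 0]. *)
    by case: (Rlt_le_dec 0 (ln d)) => // /sqrt_neg_0 sq; rewrite sq in s5; lra.
  have s2 : sqrt (ln d) ^ 2 = ln d by rewrite /= Rmult_1_r sqrt_sqrt; lra.
  have d_def : d = exp (sqrt (ln d) ^ 2) by rewrite s2 exp_ln.
  have [n0 n0P] := eventually_INR_ge ((sqrt (ln d) ^ 2 + 1) * (1 + d) + d + 2).
  apply: (@whp_of_rate _ (2 * exp (6 * d) * (8 ^ 8 * d ^ 4)) n0) => n /n0P nbig.
  by apply: prob_Gnm_connected_ge s5 d_def nbig _; rewrite s2; apply: kn.
have k0 n : k n = 0%N.
  have := kn n; rewrite Rminus_diag !Rmult_0_l => k0; apply: INR_eq.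
  by have := pos_INR (k n); rewrite /=; lra.
have [n0 n0P] := eventually_INR_ge (d + 1).
by apply: (@whp_of_rate _ 0 n0) => n /n0P nd; rewrite k0; apply: prob_Gnm_Sk0_ge.
Qed.
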